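(* Let $(M_n)_{n\ge1}$ be some sequence of $d\times d$ doubly-stochastic matrices. Assume that there exists some constant $\gamma>0$ such that for every $n\ge1$ and $i$ in $\{1,\dots,d\}$, $M_n(i,i)\ge\gamma$. Then the sequence $(M_n\cdots M_1)_{n\ge1}$ has a finite variation, so it converges to some stochastic matrix $L$. Moreover, the series $\sum_nM_n(i,j)$ and $\sum_nM_n(j,i)$ converge whenever the rows of $L$ with indexes $i$ and $j$ are different.
   Context: A stochastic matrix is a real matrix with non-negative entries whose rows each sum to $1$; a doubly-stochastic matrix is a square stochastic matrix whose columns also each sum to $1$. A sequence $(x_n)$ in a normed vector space $(E,\|\cdot\|)$ has a finite variation if the series $\sum_n\|x_{n+1}-x_n\|$ converges. *)

(* Defs.v *)
From HB Require Import structures.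
From mathcomp Require Import all_boot all_order all_algebra.
From mathcomp Require Import all_classical all_reals all_analysis.
Import Order.TTheory GRing.Theory Num.Theory.
Import numFieldNormedType.Exports.

Set Implicit Arguments.
Unset Strict Implicit.
Unset Printing Implicit Defensive.

Local Open Scope classical_set_scope.
Local Open Scope ring_scope.

Definition stochastic (R : realType) (m n : nat) (A : 'M[R]_(m, n)) : Prop :=
  (forall i j, 0 <= A i j) /\ (forall i, \sum_j A i j = 1).

Definition doubly_stochastic (R : realType) (d : nat) (A : 'M[R]_d) : Prop :=
  stochastic A /\ (forall j, \sum_i A i j = 1).

Definition finite_variation (R : realType) (E : normedModType R)
    (x : nat -> E) : Prop :=
  cvgn (series (fun n => `|x n.+1 - x n|)).

(* Sequences (M_n)_(n >= 1) are indexed from 0: M k stands for M_(k+1), and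
   backward_product M k = M k *m ... *m M 0 stands for M_(k+1) ... M_1. *)
Fixpoint backward_product (R : realType) (d : nat) (M : nat -> 'M[R]_d)
    (n : nat) : 'M[R]_d :=
  if n is k.+1 then M k.+1 *m backward_product M k else M 0%N.

(* Main.v *)
Require Import Defs.
From HB Require Import structures.
From mathcomp Require Import all_boot all_order all_algebra.
From mathcomp Require Import all_classical all_reals all_analysis.
From mathcomp Require Import ring lra.
Import Order.TTheory GRing.Theory Num.Theory.
Import numFieldNormedType.Exports.

Set Implicit Arguments.
Unset Strict Implicit.
Unset Printing Implicit Defensive.

Local Open Scope classical_set_scope.
Local Open Scope ring_scope.

(** The proof rests on a Lyapunov function.  For a vector x and a size k, let
    f_k(x) be the largest sum of k coordinates of x.  If A is doubly
    stochastic, a sum of k coordinates of A x is a weighted sum of all the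
    coordinates of x, with weights in [0,1] of total mass k (the partial column
    sums of A); hence f_k(A x) <= f_k(x) ([top_sum_mulmx_le]).

    The decrease is quantified by gaps.  Suppose that the k coordinates indexed
    by T are all >= t1 and the other ones all <= t0.  Then f_k(x) - f_k(A x) is
    at least (t1 - t0) times the mass that the weights put outside T, and this
    mass is at least gamma * A i j whenever T separates i from j
    ([top_sum_drop]): if S is the set of k coordinates that is optimal for A x,
    then either i lies on the same side of S and T, and the entry A i j itself
    crosses T, or i lies on opposite sides, and the diagonal entry A i i >= gamma
    does.  Note that this estimate is linear in the gap; the more obvious
    Lyapunov function, the sum of the squares of the coordinates, only gives
    square summability of the increments.

    Among d values, two unequal ones x_i and x_j are always separated by a gap of
    length at least |x_i - x_j| / d ([separating_gap]).  Adding up the functions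
    f_k therefore gives an energy F, nonnegative on nonnegative vectors, with
      A i j * |x_i - x_j| <= (d / gamma) * (F(x) - F(A x))
    ([top_energy_drop]).  Apply this to the columns of P_n = M_n ... M_1: the
    right-hand sides telescope, so that the series of
    M_(n+1) i j * |P_n i k - P_n j k| converges for all i, j and k.
    Since the entries of P_(n+1) - P_n = (M_(n+1) - 1) P_n are sums of terms
    M_(n+1) i j * (P_n j k - P_n i k), finite variation follows.  And if the rows
    i and j of the limit differ in column k, the factor |P_n i k - P_n j k| is
    eventually bounded below, so that the series of M_n i j itself converges;
    the roles of i and j can be exchanged. *)

(** * Largest sums of a given number of coordinates *)

(** The number of coordinates is given as the cardinal of a set T, rather than
    as a number k, so that T itself witnesses that such sets exist. *)
Definition top_set (R : realType) (d : nat) (T : {set 'I_d}) (x : 'cV[R]_d) :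
    {set 'I_d} :=
  [arg max_(S > T | #|S| == #|T|) \sum_(l in S) x l 0]%O.

Definition top_sum (R : realType) (d : nat) (T : {set 'I_d}) (x : 'cV[R]_d) :=
  \sum_(l in top_set T x) x l 0.

Lemma top_setP (R : realType) (d : nat) (T : {set 'I_d}) (x : 'cV[R]_d) :
  #|top_set T x| = #|T| /\
  forall S : {set 'I_d}, #|S| = #|T| -> \sum_(l in S) x l 0 <= top_sum T x.
Proof.
rewrite /top_sum /top_set; case: arg_maxP => [|S /eqP cS maxS]; first exact: eqxx.
by split=> // S' /eqP; exact: maxS.
Qed.

(** Otherwise exchanging a and b would increase the sum. *)
Lemma top_set_ge (R : realType) (d : nat) (T : {set 'I_d}) (x : 'cV[R]_d) a b :
  a \in top_set T x -> b \notin top_set T x -> x b 0 <= x a 0.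
Proof.
have [cT maxT] := top_setP T x; rewrite /top_sum in maxT.
set S := top_set T x in cT maxT * => aS bS.
have bSa : b \notin S :\ a by rewrite !inE (negPf bS) andbF.
have := maxT (b |: (S :\ a)).
rewrite cardsU1 bSa -cT (cardsD1 a S) aS => /(_ erefl).
by rewrite big_setU1 //= (big_setD1 a aS) /= lerD2r.
Qed.

Lemma top_sum_ge0 (R : realType) (d : nat) (T : {set 'I_d}) (x : 'cV[R]_d) :
  (forall l, 0 <= x l 0) -> 0 <= top_sum T x.
Proof. by move=> x_ge0; apply: sumr_ge0. Qed.

(** Going from the indicator function of T to the weights c moves mass from T to
    its complement; the mass removed is the mass added, and each unit moved
    loses at least t1 - t0. *)
Lemma set_sum_sub_weighted_sum (R : realType) (d : nat) (x : 'cV[R]_d)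
    (T : {set 'I_d}) (c : 'I_d -> R) (t0 t1 : R) :
  (forall l, 0 <= c l <= 1) -> \sum_l c l = #|T|%:R ->
  (forall l, l \in T -> t1 <= x l 0) -> (forall l, l \notin T -> x l 0 <= t0) ->
  \sum_(l in T) (1 - c l) = \sum_(l | l \notin T) c l /\
  (t1 - t0) * \sum_(l | l \notin T) c l <=
    \sum_(l in T) x l 0 - \sum_l c l * x l 0.
Proof.
move=> c01 sumc xT xnT.
have eqmass : \sum_(l in T) (1 - c l) = \sum_(l | l \notin T) c l.
  move: sumc; rewrite (bigID (mem T)) /= sumrB sumr_const => <-.
  by rewrite addrAC subrr add0r.
split=> //; rewrite [\sum_l c l * x l 0](bigID (mem T)) /= opprD addrA -sumrB mulrBl.
rewrite -{1}eqmass !mulr_sumr lerB //; apply: ler_sum => l lT.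
  have /andP[_ c1] := c01 l; have := xT _ lT; nra.
by have /andP[c0 _] := c01 l; rewrite mulrC ler_wpM2r // xnT.
Qed.

(** * Decrease of the largest sums under a doubly stochastic matrix *)

Section one_step.
Variables (R : realType) (d : nat) (A : 'M[R]_d).
Hypothesis A_ds : doubly_stochastic A.

Lemma ds_ge0 i j : 0 <= A i j.
Proof. by case: A_ds => -[]. Qed.

Lemma col_mass_subr1 (S : {set 'I_d}) l :
  1 - \sum_(i in S) A i l = \sum_(i | i \notin S) A i l.
Proof. by case: A_ds => _ /(_ l) <-; rewrite (bigID (mem S)) /= addrAC subrr add0r. Qed.

Lemma col_mass01 (S : {set 'I_d}) l : 0 <= \sum_(i in S) A i l <= 1.
Proof.
rewrite sumr_ge0 /=; last by move=> *; exact: ds_ge0.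
by rewrite -subr_ge0 col_mass_subr1 sumr_ge0 // => *; exact: ds_ge0.
Qed.

Lemma sum_col_mass (S : {set 'I_d}) : \sum_l \sum_(i in S) A i l = #|S|%:R.
Proof.
rewrite exchange_big /= -sumr_const; apply: eq_bigr => i _.
by case: A_ds => -[_ ->].
Qed.

Lemma sum_mulmx (S : {set 'I_d}) (x : 'cV[R]_d) :
  \sum_(i in S) (A *m x) i 0 = \sum_l (\sum_(i in S) A i l) * x l 0.
Proof.
under eq_bigr do rewrite mxE.
by rewrite exchange_big /=; apply: eq_bigr => l _; rewrite mulr_suml.
Qed.

(** The weights are compared with the optimal set for x, whose smallest
    coordinate serves as both thresholds t0 = t1. *)
Lemma top_sum_mulmx_le (T : {set 'I_d}) (x : 'cV[R]_d) :
  top_sum T (A *m x) <= top_sum T x.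
Proof.
rewrite {1}/top_sum; set S := top_set T (A *m x).
have cS : #|S| = #|T| by case: (top_setP T (A *m x)).
have cT : #|top_set T x| = #|T| by case: (top_setP T x).
have [T0|[a0 a0T]] := set_0Vmem (top_set T x).
  have S0 : S = finset.set0.
    by apply/eqP; rewrite -cards_eq0 cS -cT T0 cards0.
  by rewrite S0 /top_sum T0 !big_set0.
case: (@arg_minP _ _ _ a0 (mem (top_set T x)) (fun l => x l 0) a0T) => a aT amin.
have sumc : \sum_l \sum_(i in S) A i l = #|top_set T x|%:R.
  by rewrite sum_col_mass cS cT.
have xT l : l \in top_set T x -> x a 0 <= x l 0 by exact: amin.
have xnT l : l \notin top_set T x -> x l 0 <= x a 0 by exact: top_set_ge.
have [_] := set_sum_sub_weighted_sum (col_mass01 S) sumc xT xnT.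
by rewrite subrr mul0r subr_ge0 sum_mulmx.
Qed.

Variable gamma : R.
Hypothesis gamma_gt0 : 0 < gamma.
Hypothesis A_diag : forall i, gamma <= A i i.

(** The mass moved across T is bounded below by a single entry of A, either
    A i j or A i i, according to the position of i with respect to T and to the
    optimal set S for A x. *)
Lemma top_sum_drop (T : {set 'I_d}) (x : 'cV[R]_d) (t0 t1 : R) i j :
  t0 <= t1 ->
  (forall l, l \in T -> t1 <= x l 0) -> (forall l, l \notin T -> x l 0 <= t0) ->
  (i \in T) != (j \in T) ->
  gamma * A i j * (t1 - t0) <= top_sum T x - top_sum T (A *m x).
Proof.
move=> t01 xT xnT ijT.
have [cS _] := top_setP T (A *m x); rewrite {2}/top_sum.
set S := top_set T (A *m x) in cS *.
have sumc : \sum_l \sum_(i in S) A i l = #|T|%:R by rewrite sum_col_mass cS.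
have c01 := col_mass01 S.
have [eqmass drop] := set_sum_sub_weighted_sum c01 sumc xT xnT.
have maxT : \sum_(l in T) x l 0 <= top_sum T x by apply: (top_setP T x).2.
rewrite sum_mulmx; apply: le_trans (le_trans drop _); last by rewrite lerD2r.
rewrite mulrC ler_wpM2l ?subr_ge0 //.
have A0 := ds_ge0.
have A1 k l : A k l <= 1.
  case: A_ds => -[_ /(_ k)] <- _; rewrite (bigD1 l) //= lerDl sumr_ge0 //.
have leA : gamma * A i j <= A i j.
  by rewrite ler_piMl // (le_trans (A_diag i)).
have leg : gamma * A i j <= gamma by rewrite ler_piMr // ltW.
(* Bounds on the mass moved across T: an entry A k l counts towards it when l is
   outside T and k inside S (mass put outside T), or when l is inside T and k
   outside S (mass missing in T). *)
have ge_in k l : l \notin T -> k \in S ->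
    A k l <= \sum_(l | l \notin T) \sum_(i in S) A i l.
  move=> lT kS; rewrite (bigD1 l) //= (bigD1 k) //= -addrA lerDl.
  rewrite addr_ge0 ?sumr_ge0 //.
  by move=> m _; rewrite sumr_ge0.
have ge_out k l : l \in T -> k \notin S ->
    A k l <= \sum_(l | l \notin T) \sum_(i in S) A i l.
  move=> lT kS; rewrite -eqmass (bigD1 l) //= col_mass_subr1 (bigD1 k) //=.
  rewrite -addrA lerDl addr_ge0 ?sumr_ge0 // => m _.
  by rewrite col_mass_subr1 sumr_ge0.
have [iT|iT] := boolP (i \in T); have [iS|iS] := boolP (i \in S).
- apply: (le_trans leA); apply: ge_in => //.
  by move: ijT; rewrite iT; case: (j \in T).
- by apply: (le_trans leg); apply: (le_trans (A_diag i)); exact: ge_out.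
- by apply: (le_trans leg); apply: (le_trans (A_diag i)); exact: ge_in.
- apply: (le_trans leA); apply: ge_out => //.
  by move: ijT; rewrite (negPf iT); case: (j \in T).
Qed.

End one_step.

(** * The energy of a vector *)

(** Cut the interval from x j to x i into d intervals of equal length.  If each
    of them had a value of x in its interior, these d values would be all the
    values of x, but x j is an endpoint. *)
Lemma separating_gap (R : realType) (d : nat) (x : 'I_d -> R) i j :
  x j < x i ->
  exists (T : {set 'I_d}) (t : R),
    [/\ i \in T, j \notin T, forall l, l \in T -> t + (x i - x j) / d%:R <= x l &
        forall l, l \notin T -> x l <= t].
Proof.
move=> ltji; pose e := (x i - x j) / d%:R.
have d_gt0 : 0 < d%:R :> R by rewrite ltr0n (leq_ltn_trans _ (ltn_ord i)).
have e_gt0 : 0 < e by rewrite divr_gt0 // subr_gt0.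
pose t (m : nat) := x j + m%:R * e.
have le_t m m' : (m <= m')%N -> t m <= t m'.
  by move=> mm'; rewrite lerD2l ler_wpM2r ?ler_nat // ltW.
have [[m gap]|nogap] :=
  pselect (exists m : 'I_d, forall l, x l <= t m \/ t m.+1 <= x l).
  exists [set l | t m.+1 <= x l]%SET, (t m).
  have tS : t m + e = t m.+1 by rewrite /t -natr1; ring.
  rewrite -/e !inE tS; split.
  - apply: le_trans (le_t _ _ (ltn_ord m)) _.
    by rewrite /t /e mulrC divfK ?gt_eqF // addrC subrK.
  - by rewrite -ltNge (lt_le_trans _ (le_t 1%N m.+1 _)) // /t mul1r ltrDl.
  - by move=> l; rewrite inE.
  - by move=> l; rewrite inE => /negP ?; case: (gap l).
have hit (m : 'I_d) : exists l, t m < x l < t m.+1.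
  apply: contra_notP nogap => /forallNP nohit; exists m => l.
  by have /negP := nohit l; rewrite negb_and -!leNgt => /orP.
have [f fP] := choice hit.
have f_inj : injective f.
  suff neq (m m' : 'I_d) : (m < m')%N -> f m <> f m'.
    move=> m m' fmm'; apply/val_inj/eqP => /=.
    by case: ltngtP => // /neq; rewrite fmm'.
  move=> mm' fmm'; have /andP[_ u] := fP m; have /andP[v _] := fP m'.
  have := le_t _ _ mm'; rewrite leNgt => /negP; apply.
  by rewrite (lt_trans v) // -fmm'.
have /codomP[m jE] := injF_onto f_inj j.
have /andP[+ _] := fP m; rewrite -jE ltNge => /negP[].
by rewrite lerDl mulr_ge0 // ltW.
Qed.

(** The sum runs over sets T rather than over their cardinals, so each size is
    counted several times; this only affects constants. *)
Definition top_energy (R : realType) (d : nat) (x : 'cV[R]_d) :=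
  \sum_(T : {set 'I_d}) top_sum T x.

Lemma top_energy_mulmx_le (R : realType) (d : nat) (A : 'M[R]_d) (x : 'cV[R]_d) :
  doubly_stochastic A -> top_energy (A *m x) <= top_energy x.
Proof. by move=> A_ds; apply: ler_sum => T _; exact: top_sum_mulmx_le. Qed.

(** The gap that separates i from j makes one of the terms of the energy decrease
    by the required amount, and no term increases. *)
Lemma top_energy_drop (R : realType) (d : nat) (A : 'M[R]_d) (gamma : R)
    (x : 'cV[R]_d) i j :
  doubly_stochastic A -> 0 < gamma -> (forall i, gamma <= A i i) ->
  A i j * `|x i 0 - x j 0| <=
    d%:R / gamma * (top_energy x - top_energy (A *m x)).
Proof.
move=> A_ds g_gt0 A_diag.
have d_gt0 : 0 < d%:R :> R by rewrite ltr0n (leq_ltn_trans _ (ltn_ord i)).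
have coef_ge0 : 0 <= d%:R / gamma by rewrite divr_ge0 // ltW.
suff drop (T : {set 'I_d}) (t : R) :
    (forall l, l \in T -> t + `|x i 0 - x j 0| / d%:R <= x l 0) ->
    (forall l, l \notin T -> x l 0 <= t) -> (i \in T) != (j \in T) ->
    A i j * `|x i 0 - x j 0| <=
      d%:R / gamma * (top_energy x - top_energy (A *m x)).
  have [lt|lt|eq] := ltgtP (x i 0) (x j 0).
  - have [T [t [jT iT xT xnT]]] := separating_gap (x := fun l => x l 0) lt.
    apply: (drop T t) => //; last by rewrite jT (negPf iT).
    by rewrite ltr0_norm ?subr_lt0 // opprB.
  - have [T [t [iT jT xT xnT]]] := separating_gap (x := fun l => x l 0) lt.
    apply: (drop T t) => //; last by rewrite iT (negPf jT).
    by rewrite gtr0_norm ?subr_gt0.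
  - by rewrite eq subrr normr0 mulr0 mulr_ge0 // subr_ge0 top_energy_mulmx_le.
move=> xT xnT ijT; set v : R := `|x i 0 - x j 0| in xT *.
have tt : t <= t + v / d%:R by rewrite lerDl divr_ge0 ?normr_ge0 // ltW.
have := top_sum_drop A_ds g_gt0 A_diag tt xT xnT ijT; rewrite (addrAC t) subrr add0r.
have -> : A i j * v = d%:R / gamma * (gamma * A i j * (v / d%:R)).
  by field; rewrite !gt_eqF.
move=> le; rewrite ler_wpM2l //; apply: le_trans le _.
rewrite -sumrB (bigD1 T) //= lerDl sumr_ge0 // => T' _.
by rewrite subr_ge0 top_sum_mulmx_le.
Qed.

(** * Convergence criteria *)

Lemma cvg_series_of_drop (R : realType) (u v : nat -> R) :
  (forall n, 0 <= u n) -> (forall n, 0 <= v n) ->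
  (\forall n \near \oo, u n <= v n - v n.+1) -> cvgn (series u).
Proof.
move=> u_ge0 v_ge0 [N _ drop].
have ndu : nondecreasing_seq (series u) by exact: nondecreasing_series.
apply: nondecreasing_is_cvgn => //; exists (series u N + v N) => _ [n _ <-].
apply: (@le_trans _ _ (series u (N + n)%N)); first by rewrite ndu ?leq_addl.
suff : series u (N + n)%N + v (N + n)%N <= series u N + v N.
  by apply: le_trans; rewrite lerDl.
elim: n => [|n IHn]; first by rewrite addn0.
apply: le_trans IHn; rewrite addnS seriesSr -addrA lerD2l.
by rewrite -lerBrDr drop //= leq_addr.
Qed.

Lemma mx_finite_variation_is_cvg (R : realType) (m n : nat)
    (x : nat -> 'M[R]_(m, n)) :
  finite_variation x -> cvgn x.
Proof.
rewrite /finite_variation => /cauchy_cvgP/cauchy_seriesP x_var.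
have -> : x = (fun n => x 0%N + series (telescope x) n).
  by apply/funext => k; rewrite -eq_sum_telescope.
apply: is_cvgD; first exact: is_cvg_cst.
apply: cauchy_cvg; apply/cauchy_seriesP => e /x_var.
apply: filterS => k /=; rewrite ger0_norm ?sumr_ge0//.
by apply: le_lt_trans; apply: ler_norm_sum.
Qed.

(** * Products and limits of stochastic matrices *)

Lemma stochastic_mulmx (R : realType) (m n p : nat) (A : 'M[R]_(m, n))
    (B : 'M[R]_(n, p)) :
  stochastic A -> stochastic B -> stochastic (A *m B).
Proof.
move=> [A0 A1] [B0 B1]; split=> [i k|i].
  by rewrite mxE sumr_ge0 // => j _; exact: mulr_ge0.
under eq_bigr do rewrite mxE.
rewrite exchange_big /= -(A1 i); apply: eq_bigr => j _.
by rewrite -mulr_sumr B1 mulr1.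
Qed.

Lemma backward_product_stochastic (R : realType) (d : nat)
    (M : nat -> 'M[R]_d) n :
  (forall n, stochastic (M n)) -> stochastic (backward_product M n).
Proof. by move=> M_st; elim: n => //= n; exact: stochastic_mulmx. Qed.

Lemma cvg_coord (R : realType) (m n : nat) (x : nat -> 'M[R]_(m, n))
    (L : 'M[R]_(m, n)) i j :
  x k @[k --> \oo] --> L -> x k i j @[k --> \oo] --> L i j.
Proof.
move=> xL; apply: (cvg_comp x (fun A : 'M[R]_(m, n) => A i j) xL).
exact: coord_continuous.
Qed.

Lemma stochastic_cvg (R : realType) (m n : nat) (x : nat -> 'M[R]_(m, n))
    (L : 'M[R]_(m, n)) :
  (forall k, stochastic (x k)) -> x k @[k --> \oo] --> L -> stochastic L.
Proof.
move=> x_st xL; split=> [i j|i].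
  have : x k i j @[k --> \oo] --> L i j by exact: cvg_coord.
  apply: (@closed_cvg _ _ _ _ _ (fun y : R => 0 <= y)).
    exact: closed_ge.
  by near=> k; case: (x_st k).
have sumL : \sum_j x k i j @[k --> \oo] --> \sum_j L i j.
  by apply: cvg_big => [|j _]; [exact: add_continuous | exact: cvg_coord].
apply: (cvg_unique _ sumL) => //=.
under eq_fun do rewrite (x_st _).2.
exact: cvg_cst.
Unshelve. all: by end_near. Qed.

(** * The energy of a matrix *)

Lemma col_mulmx (R : realType) (m n p : nat) (A : 'M[R]_(m, n))
    (B : 'M[R]_(n, p)) k : col k (A *m B) = A *m col k B.
Proof. by rewrite !colE mulmxA. Qed.

Definition energy (R : realType) (d m : nat) (P : 'M[R]_(d, m)) :=
  \sum_k top_energy (col k P).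

Lemma energy_ge0 (R : realType) (d m : nat) (P : 'M[R]_(d, m)) :
  (forall i k, 0 <= P i k) -> 0 <= energy P.
Proof.
move=> P0; apply: sumr_ge0 => k _; apply: sumr_ge0 => T _.
by apply: top_sum_ge0 => l; rewrite mxE.
Qed.

Lemma energyB_mulmx (R : realType) (d m : nat) (A : 'M[R]_d) (P : 'M[R]_(d, m)) :
  energy P - energy (A *m P) =
    \sum_k (top_energy (col k P) - top_energy (A *m col k P)).
Proof. by rewrite -sumrB; apply: eq_bigr => k _; rewrite col_mulmx. Qed.

Lemma energy_drop (R : realType) (d m : nat) (A : 'M[R]_d) (gamma : R)
    (P : 'M[R]_(d, m)) i j k :
  doubly_stochastic A -> 0 < gamma -> (forall i, gamma <= A i i) ->
  A i j * `|P i k - P j k| <= d%:R / gamma * (energy P - energy (A *m P)).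
Proof.
move=> A_ds g0 A_diag.
have := top_energy_drop (col k P) i j A_ds g0 A_diag; rewrite !mxE => le.
apply: (le_trans le); rewrite ler_wpM2l ?divr_ge0 ?ler0n ?(ltW g0) //.
rewrite energyB_mulmx (bigD1 k) //= lerDl sumr_ge0 // => l _.
by rewrite subr_ge0 top_energy_mulmx_le.
Qed.

(** As the rows of A sum to 1, the entry (i, k) of A P - P is an average of the
    differences P j k - P i k with weights A i j. *)
Lemma norm_mulmx_sub_le (R : realType) (d m : nat) (A : 'M[R]_d) (gamma : R)
    (P : 'M[R]_(d, m)) :
  doubly_stochastic A -> 0 < gamma -> (forall i, gamma <= A i i) ->
  `|A *m P - P| <= d%:R * (d%:R / gamma * (energy P - energy (A *m P))).
Proof.
move=> A_ds g0 A_diag; rewrite [leLHS]/Num.Def.normr /= mx_normrE.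
apply: bigmax_le => [|[i k] _ /=].
  rewrite !mulr_ge0 ?invr_ge0 ?ler0n ?(ltW g0) // energyB_mulmx.
  by rewrite sumr_ge0 // => k _; rewrite subr_ge0 top_energy_mulmx_le.
have [[A0 A1] _] := A_ds.
have -> : (A *m P - P) i k = \sum_j A i j * (P j k - P i k).
  rewrite !mxE; under [RHS]eq_bigr do rewrite mulrBr.
  by rewrite sumrB -mulr_suml A1 mul1r.
apply: le_trans (ler_norm_sum _ _ _) _.
rewrite mulr_natl -[d in _ *+ d]card_ord -sumr_const; apply: ler_sum => j _.
by rewrite normrM ger0_norm // distrC energy_drop.
Qed.

(** * Finite variation of the products *)

Theorem theorem8 (R : realType) (d : nat) (M : nat -> 'M[R]_d)
    (M_ds : forall n, doubly_stochastic (M n))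
    (gamma : R) (gamma_gt0 : 0 < gamma)
    (M_diag : forall n i, gamma <= M n i i) :
  finite_variation (backward_product M) /\
  exists L : 'M[R]_d,
    [/\ stochastic L,
        backward_product M n @[n --> \oo] --> L &
        forall i j, row i L <> row j L ->
          cvgn (series (fun n => M n i j)) /\
          cvgn (series (fun n => M n j i))].
Proof.
pose P := backward_product M.
pose C := d%:R / gamma : R.
have C_ge0 : 0 <= C by rewrite divr_ge0 ?ler0n // ltW.
have M_st n : stochastic (M n) by case: (M_ds n).
have P_st n : stochastic (P n) by exact: backward_product_stochastic.
have P_energy_ge0 n : 0 <= energy (P n) by apply: energy_ge0; case: (P_st n).
have P_var : finite_variation P.
  apply: (@cvg_series_of_drop _ _ (fun n => d%:R * (C * energy (P n)))).
  - by move=> n; exact: normr_ge0.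
  - by move=> n; apply: mulr_ge0 => //; exact: mulr_ge0.
  - by near=> n; rewrite -!mulrBr; exact: norm_mulmx_sub_le.
split=> //.
have /cvg_ex[L PL] := mx_finite_variation_is_cvg P_var; exists L; split=> //.
  exact: stochastic_cvg P_st PL.
suff M_sum i j k : L i k != L j k -> cvgn (series (fun n => M n i j)).
  move=> i j rowL.
  have [k neqL] : exists k, L i k != L j k.
    apply: contra_notP rowL => /forallNP eqL; apply/rowP => k; rewrite !mxE.
    by apply/eqP/negPn/negP; exact: eqL.
  by split; apply: (M_sum _ _ k); rewrite // eq_sym.
move=> neqL; pose e := `|L i k - L j k| / 2.
have L_gt0 : 0 < `|L i k - L j k| by rewrite normr_gt0 subr_eq0.
have e_gt0 : 0 < e by rewrite divr_gt0.
have gap : \forall n \near \oo, e <= `|P n i k - P n j k|.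
  have : `|P n i k - P n j k| @[n --> \oo] --> `|L i k - L j k|.
    by apply: cvg_norm; apply: cvgB; exact: cvg_coord.
  by move=> /cvgr_ge; apply; rewrite /e; lra.
(* M n i j is controlled by the step from P n.-1 to P n; there is no such step
   for n = 0, which the eventual inequality ignores. *)
apply: (@cvg_series_of_drop _ _ (fun n => e^-1 * (C * energy (P n.-1)))).
- by move=> n; case: (M_st n).
- by move=> n; apply: mulr_ge0; [rewrite invr_ge0 ltW | exact: mulr_ge0].
- case: gap => N _ gap; exists N.+1 => // -[//|n] /= Nn.
  rewrite -!mulrBr mulrC ler_pdivlMr //.
  apply: le_trans (energy_drop (P n) i j k (M_ds n.+1) gamma_gt0 (M_diag n.+1)).
  by rewrite ler_wpM2l ?gap //; case: (M_st n.+1).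
Unshelve. all: by end_near. Qed.
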